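(* Let $f$ be a conformal map of $\mathbb{D}$ onto the exterior of an $(n+2)$-gon, with the normalization $f(0)=\infty$, and let $k,m$ be the degrees of the finite Blaschke products $B_k,B_m$ in the representation $$z\frac{f''(z)}{f'(z)}=\frac{2}{z^2B_k(z)/B_m(z)-1},\qquad z\in\mathbb{D},$$ where $B_k$ and $B_m$ have no common zeros. (i) If $|b|>1$, then $\#\{z\in\mathbb{D}: P_f(z)=b\}=m$. (ii) If $|a|<1$, then $\#\{z\in\mathbb{D}: P_f(z)=a\}=k+3$. Here solutions are counted with multiplicity.
   Context: $\mathbb{D}=\{z\in\mathbb{C}:|z|<1\}$ and $\hat{\mathbb{C}}=\mathbb{C}\cup\{\infty\}$. The map $f$ is meromorphic and univalent in $\mathbb{D}$ with a simple pole at $0$, and its image is the complement in $\hat{\mathbb{C}}$ of a closed bounded polygon with $n+2$ vertices. It is known (earlier work) that for such $f$ the displayed representation holds for some finite Blaschke products $B_k,B_m$, of degrees $k$ and $m$ respectively, without common zeros, and that $m$ and $k+2$ are the numbers of concave and convex vertices of the polygon, respectively. A finite Blaschke product of degree $d$ is $e^{i\theta}\prod_{j=1}^{d}\frac{z-a_j}{1-\overline{a_j}z}$ with $\theta\in\mathbb{R}$, $a_j\in\mathbb{D}$. The pole function is the meromorphic function $P_f(z)=z+2\,f'(z)/f''(z)$ in $\mathbb{D}$ (extended meromorphically across $z=0$), with value $\infty$ where $f''/f'$ vanishes. *)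

(* Defs.v *)
From HB Require Import structures.
From mathcomp Require Import all_boot all_order all_algebra.
From mathcomp Require Import all_classical all_reals all_analysis.
From mathcomp Require Import complex.

Set Implicit Arguments.
Unset Strict Implicit.
Unset Printing Implicit Defensive.

Import Order.TTheory GRing.Theory Num.Theory.
Import numFieldNormedType.Exports.

Local Open Scope classical_set_scope.
Local Open Scope complex_scope.
Local Open Scope ring_scope.

(* Declared as a [numClosedFieldType] so that the norm, topology and
   derivative that the library attaches to every [numFieldType] apply to
   [R[i]]; in particular [derive1] on [CC R] is the complex derivative. *)
Definition CC (R : realType) : numClosedFieldType := R[i].

(* The Riemann sphere: [None] is the point at infinity. *)
Definition sphere (R : realType) : Type := option (CC R).

(* Junk value 0 at infinity. *)
Definition fin (R : realType) (F : CC R -> sphere R) : CC R -> CC R :=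
  fun z => odflt 0 (F z).

Definition disc (R : realType) : set (CC R) := [set z | `|z| < 1].

(* The meromorphic function g has order p at z0. Only the values of g in a
   punctured neighbourhood matter. *)
Definition has_order (R : realType) (g : CC R -> CC R) (z0 : CC R) (p : int)
    : Prop :=
  exists h : CC R -> CC R,
    [/\ \forall z \near z0, derivable h z 1,
        h z0 != 0
      & \forall z \near z0^', g z = (z - z0) ^ p * h z].

(* The value at z0 of the meromorphic function that g defines near z0: its
   finite limit if there is one, and otherwise z0 is a pole. *)
Definition mero_value (R : realType) (g : CC R -> CC R) : CC R -> sphere R :=
  fun z0 => if `[< cvg (g z @[z --> z0^']) >]
            then Some (lim (g z @[z --> z0^'])) else None.

Definition segment (R : realType) (u v : CC R) : set (CC R) :=
  [set z | exists t : R, 0 <= t <= 1 /\ z = u + t%:C * (v - u)].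

(* Side from the vertex w i to the cyclically next vertex. *)
Definition side (R : realType) (N : nat) (w : 'I_N -> CC R) (i : 'I_N) :
    set (CC R) :=
  segment (w i) (w (ordS i)).

(* Vertices, in cyclic order, of a simple closed polygonal line. The last
   clause (three consecutive vertices are not collinear) makes every w i a
   genuine corner, so that N really is the number of vertices. *)
Definition simple_polygon (R : realType) (N : nat) (w : 'I_N -> CC R) : Prop :=
  [/\ injective w,
      forall i j, i != j -> side w i `&` side w j =
        [set z | (j = ordS i /\ z = w j) \/ (i = ordS j /\ z = w i)]
    & forall i, 'Im ((w (ordS (ordS i)) - w (ordS i)) *
                     (w (ordS i) - w i)^*) != 0].

Definition polygonal_line (R : realType) (N : nat) (w : 'I_N -> CC R) :
    set (CC R) :=
  \bigcup_(i in [set: 'I_N]) side w i.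

(* The polygonal line together with its interior, i.e. the bounded
   components of its complement. *)
Definition closed_polygon (R : realType) (N : nat) (w : 'I_N -> CC R) :
    set (CC R) :=
  polygonal_line w `|`
  [set z | ~ polygonal_line w z /\
           bounded_set (connected_component (~` polygonal_line w) z)].

(* f is a meromorphic univalent map of the disc onto the complement of K in
   the sphere, with a simple pole at 0. Injectivity and f 0 = None make f
   finite elsewhere in the disc. *)
Definition conformal_onto_exterior (R : realType) (f : CC R -> sphere R)
    (K : set (CC R)) : Prop :=
  [/\ forall z, disc z -> z != 0 -> derivable (fin f) z 1,
      f 0 = None /\ has_order (fin f) 0 (- 1),
      forall z1 z2, disc z1 -> disc z2 -> f z1 = f z2 -> z1 = z2
    & f @` (@disc R) = ~` (Some @` K)].

Definition finite_blaschke (R : realType) (d : nat) (B : CC R -> CC R) : Prop :=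
  exists (theta : R) (a : 'I_d -> CC R),
    (forall j, disc (a j)) /\
    (forall z, disc z ->
       B z = (cos theta +i* sin theta) *
             \prod_(j < d) ((z - a j) / (1 - (a j)^* * z))).

(* z f''/f' = 2 / (z^2 B_k/B_m - 1) as meromorphic functions on the disc: the
   two sides agree off a discrete set. The first clause says that the
   denominator is not identically zero, i.e. that the right-hand side is a
   meromorphic function (here 2 / 0 = 0). *)
Definition blaschke_representation (R : realType) (f : CC R -> sphere R)
    (Bk Bm : CC R -> CC R) : Prop :=
  forall z0 : CC R, disc z0 -> \forall z \near z0^',
    z ^+ 2 * Bk z / Bm z - 1 != 0 /\
    z * (derive1 (derive1 (fin f)) z / derive1 (fin f) z) =
      2 / (z ^+ 2 * Bk z / Bm z - 1).

Definition pole_function (R : realType) (f : CC R -> sphere R) :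
    CC R -> sphere R :=
  mero_value
    (fun z => z + 2 * (derive1 (fin f) z / derive1 (derive1 (fin f)) z)).

(* The equation F z = b has exactly N solutions in A, counted with
   multiplicity: s lists the distinct solutions and mu z is the order of the
   zero of F - b at z. *)
Definition nb_solutions (R : realType) (F : CC R -> sphere R) (A : set (CC R))
    (b : CC R) (N : nat) : Prop :=
  exists (s : seq (CC R)) (mu : CC R -> nat),
    [/\ uniq s,
        forall z, z \in s <-> A z /\ F z = Some b,
        forall z, z \in s -> has_order (fun x => fin F x - b) z (mu z)%:Z
      & (\sum_(z <- s) mu z)%N = N].

(* Main.v *)
Require Import Defs.
From HB Require Import structures.
From mathcomp Require Import all_boot all_order all_algebra.
From mathcomp Require Import all_classical all_reals all_analysis.
From mathcomp Require Import complex.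
From mathcomp Require Import ring lra.

Set Implicit Arguments.
Unset Strict Implicit.
Unset Printing Implicit Defensive.

Import Order.TTheory GRing.Theory Num.Theory.
Import numFieldNormedType.Exports.
Local Open Scope classical_set_scope.
Local Open Scope ring_scope.

(** The representation says that z f''/f' = 2 / (g - 1) with
    g = z^2 Bk / Bm, so wherever g <> 1 the pole function is
      z + 2 f'/f'' = z + z (g - 1) = z g = z^3 Bk / Bm.
    Finite Blaschke products are quotients of polynomials, hence the pole
    function is a rational function Q / B on the disc, with |Q| = |B| <> 0 on
    the unit circle.  Its b-points are the roots of Q - b B, and Rouche's
    theorem compares them with the roots of B when |b| > 1 (there are m in the
    disc) and with the roots of Q when |b| < 1 (the k roots of Bk and a triple
    root at 0).

    This count is right only if Q and B have no common root in the disc.  Since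
    Bk and Bm have none, the point to prove is that Bm does not vanish at 0,
    which expresses that f is single valued near its pole, so that f' has
    residue 0 there.  With h = z f, A and B the polynomials standing for Bk and
    Bm, and D = B - z^2 A, the representation becomes
      D h'' = 2 A (h - z h')
    near 0.  If B(0) = 0 then D(0) = 0, and a second derivative of h that stays
    bounded forces A(0) h(0) = 0; but h(0) <> 0 at a simple pole, and A(0) <> 0
    because Bk and Bm have no common zero.  Complex differentiability of h
    alone gives no bound for h'' without Cauchy's theory; [singular_ode]
    uses the mean value theorem on the positive real axis instead.  There
      (D h)' = W + 2 (D' - z A) h   with   W' = (4 A + 2 z A' - D'') h,
    where no second derivative of h is left, so the Taylor coefficient of order
    2 of D h at 0 can be computed in two ways; their difference is a multiple
    of A(0) h(0).

    Rouche's theorem is proved for polynomials without integration.  For M large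
    the average of w p'(w) / p(w) over the M-th roots of unity w is the sum of
    1 / (1 - r^M) over the roots r of p, and this tends to the number of roots
    in the disc.  Two polynomials whose logarithmic derivatives are close on
    the circle therefore have the same number of roots in the disc, and the
    segment from p to p - t q is crossed in finitely many such steps. *)

(** * Archimedean estimates in the complex numbers *)

Lemma archi_CC (R : realType) (x : CC R) : exists n : nat, `|x| <= n%:R.
Proof.
have -> : `|x| = (complex.Re `|x|)%:C%C :> R[i] by rewrite RRe_real ?normr_real.
exists (Num.bound (complex.Re `|x|)).
rewrite -[_%:R](rmorph_nat (real_complex R)) lecR.
apply: ltW; apply: archi_boundP; rewrite -lecR.
by rewrite RRe_real ?normr_real //; exact: (normr_ge0 x).
Qed.

Lemma norm_pow_small (R : realType) (x e : CC R) : `|x| < 1 -> 0 < e ->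
  exists N : nat, forall M, (N <= M)%N -> `|x ^+ M| < e.
Proof.
have -> : e = (complex.Re e)%:C%C + 'i%C * (complex.Im e)%:C%C :> R[i].
  by rewrite -complexE.
move=> x1 e0; have Ie : complex.Im e = 0.
  by move: e0; rewrite -complexE ltcE => /andP[/eqP].
move: e0; rewrite Ie mulr0 addr0 => e0.
have Ex : `|x| = (complex.Re `|x|)%:C%C :> R[i] by rewrite RRe_real ?normr_real.
have e0' : 0 < complex.Re e by move: e0; rewrite ltcR.
have r0 : 0 <= complex.Re `|x| by have := normr_ge0 x; rewrite Ex ler0c.
have r1 : `|complex.Re `|x| | < 1.
  by rewrite ger0_norm //; move: x1; rewrite Ex -[1]/(1%:C%C) ltcR.
have /cvgr0Pnorm_lt /(_ _ e0') [N _ HN] := @cvg_expr R _ r1.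
exists N => M NM; rewrite normrX Ex -(rmorphXn (real_complex R)) ltcR.
by apply: le_lt_trans (HN M NM); exact: ler_norm.
Qed.

(** * Counting the roots of a polynomial in the disc *)

(** Roots are listed with multiplicity. *)
Definition roots_of (C : numClosedFieldType) (p : {poly C}) : seq C :=
  sval (closed_field_poly_normal p).

Lemma roots_ofE (C : numClosedFieldType) (p : {poly C}) :
  p = lead_coef p *: \prod_(r <- roots_of p) ('X - r%:P).
Proof. by rewrite /roots_of; case: closed_field_poly_normal. Qed.

Definition disc_roots (C : numClosedFieldType) (p : {poly C}) : nat :=
  count [pred r | `|r| < 1] (roots_of p).

Lemma perm_roots_of (C : numClosedFieldType) (c : C) (s : seq C) : c != 0 ->
  perm_eq (roots_of (c *: \prod_(r <- s) ('X - r%:P))) s.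
Proof.
move=> c0; apply: prod_XsubC_eq; set p := c *: _.
have lp : lead_coef p = c.
  by rewrite lead_coefZ (monicP (monic_prod_XsubC _ _ _)) mulr1.
by apply: (scalerI c0); rewrite -{1}lp -roots_ofE.
Qed.

Lemma mem_roots_of (C : numClosedFieldType) (p : {poly C}) (z : C) : p != 0 ->
  (z \in roots_of p) = (p.[z] == 0).
Proof.
move=> p0; rewrite -rootE [in RHS](roots_ofE p).
by rewrite rootZ ?lead_coef_eq0 // root_prod_XsubC.
Qed.

Lemma disc_rootsM (C : numClosedFieldType) (p q : {poly C}) :
  p != 0 -> q != 0 -> disc_roots (p * q) = (disc_roots p + disc_roots q)%N.
Proof.
move=> p0 q0; rewrite /disc_roots -count_cat; apply/permP.
rewrite [X in roots_of (X * _)](roots_ofE p).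
rewrite [X in roots_of (_ * X)](roots_ofE q).
rewrite -scalerAl -scalerAr scalerA -big_cat.
by apply: perm_roots_of; rewrite mulf_neq0 ?lead_coef_eq0.
Qed.

Lemma disc_rootsZ (C : numClosedFieldType) (c : C) (p : {poly C}) :
  c != 0 -> disc_roots (c *: p) = disc_roots p.
Proof.
have [->|p0] := eqVneq p 0; first by rewrite scaler0.
move=> c0; rewrite /disc_roots; apply/permP; rewrite [X in c *: X](roots_ofE p).
by rewrite scalerA; apply: perm_roots_of; rewrite mulf_neq0 ?lead_coef_eq0.
Qed.

Lemma disc_roots_prod (C : numClosedFieldType) (s : seq C) :
  disc_roots (\prod_(r <- s) ('X - r%:P)) = count [pred r | `|r| < 1] s.
Proof.
rewrite /disc_roots; apply/permP; rewrite -[X in roots_of X]scale1r.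
by apply: perm_roots_of; rewrite oner_eq0.
Qed.

Lemma disc_roots_eq0 (C : numClosedFieldType) (p : {poly C}) : p != 0 ->
  (forall z, `|z| < 1 -> p.[z] != 0) -> disc_roots p = 0%N.
Proof.
move=> p0 H; apply/eqP; rewrite eqn0Ngt -has_count; apply/hasPn => z.
by rewrite (mem_roots_of _ p0) => /eqP pz; apply/negP => /H; rewrite pz eqxx.
Qed.

Lemma logderiv_prod (C : fieldType) (c x : C) (s : seq C) :
  c != 0 -> x \notin s ->
  let p := c *: \prod_(r <- s) ('X - r%:P) in
  p^`().[x] / p.[x] = \sum_(r <- s) (x - r)^-1.
Proof.
move=> c0 xs; rewrite /= derivZ !hornerZ -mulf_div divff // mul1r.
elim: s xs => [|r s IH]; first by rewrite !big_nil derivC horner0 mul0r.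
rewrite inE negb_or => /andP[xr xs]; rewrite !big_cons derivM derivXsubC mul1r.
rewrite hornerD !hornerM hornerXsubC -(IH xs).
have p0 : (\prod_(j <- s) ('X - j%:P)).[x] != 0.
  by rewrite -rootE root_prod_XsubC.
have xr0 : x - r != 0 by rewrite subr_eq0.
field.
by rewrite p0 xr0.
Qed.

Lemma logderiv_roots (C : numClosedFieldType) (p : {poly C}) (x : C) :
  p.[x] != 0 -> p^`().[x] / p.[x] = \sum_(r <- roots_of p) (x - r)^-1.
Proof.
move=> px; have p0 : p != 0 by apply: contraNneq px => ->; rewrite horner0.
rewrite {1 2}(roots_ofE p) logderiv_prod // ?lead_coef_eq0 //.
by rewrite mem_roots_of.
Qed.

Definition unit_roots (C : numClosedFieldType) (M : nat) : seq C :=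
  roots_of ('X^M - 1).

Lemma XnsubC_lead (C : nzRingType) (M : nat) : (0 < M)%N ->
  lead_coef ('X^M - 1 : {poly C}) = 1.
Proof. by move=> M0; apply/monicP; rewrite -[1]/(1%:P) monicXnsubC. Qed.

Lemma XnsubC_neq0 (C : nzRingType) (M : nat) : (0 < M)%N ->
  ('X^M - 1 : {poly C}) != 0.
Proof. by move=> M0; rewrite -lead_coef_eq0 XnsubC_lead // oner_eq0. Qed.

Lemma size_unit_roots (C : numClosedFieldType) (M : nat) : (0 < M)%N ->
  size (unit_roots C M) = M.
Proof.
move=> M0; apply: succn_inj; rewrite -(size_prod_XsubC (unit_roots C M) id).
have <- : 'X^M - 1 = \prod_(z <- unit_roots C M) ('X - z%:P) :> {poly C}.
  by rewrite [LHS]roots_ofE XnsubC_lead // scale1r.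
exact: (size_XnsubC 1 M0).
Qed.

Lemma norm_unit_roots (C : numClosedFieldType) (M : nat) (w : C) : (0 < M)%N ->
  w \in unit_roots C M -> `|w| = 1.
Proof.
move=> M0; rewrite mem_roots_of ?XnsubC_neq0 //.
rewrite hornerD hornerN hornerC hornerXn subr_eq0 => /eqP wM.
apply/eqP; rewrite -(@pexpr_eq1 _ _ M) ?normr_ge0 //.
by rewrite -normrX wM normr1.
Qed.

(** Since w / (w - a) = 1 - a / (a - w), this is the logarithmic derivative of
    X^M - 1 at a. *)
Lemma mean_unit_roots (C : numClosedFieldType) (M : nat) (a : C) : (0 < M)%N ->
  a ^+ M != 1 ->
  M%:R^-1 * \sum_(w <- unit_roots C M) w / (w - a) = (1 - a ^+ M)^-1.
Proof.
move=> M0 aM; have M0' : M%:R != 0 :> C by rewrite pnatr_eq0 -lt0n.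
have aM0 : a ^+ M - 1 != 0 by rewrite subr_eq0.
have aM1 : 1 - a ^+ M != 0 by rewrite -opprB oppr_eq0.
have pa : ('X^M - 1).[a] = a ^+ M - 1.
  by rewrite hornerD hornerN hornerC hornerXn.
have aw : a \notin unit_roots C M by rewrite mem_roots_of ?XnsubC_neq0 // pa.
have := @logderiv_roots C ('X^M - 1) a.
rewrite pa => /(_ aM0); rewrite derivB derivC subr0 derivXn hornerMn hornerXn.
rewrite -/(unit_roots C M) => H.
have -> : \sum_(w <- unit_roots C M) w / (w - a) =
    \sum_(w <- unit_roots C M) (1 - a * (a - w)^-1).
  apply: eq_big_seq => w ws.
  have aw0 : a - w != 0 by rewrite subr_eq0; apply: contraNneq aw => ->.
  have wa0 : w - a != 0 by rewrite -opprB oppr_eq0.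
  by field; rewrite aw0 wa0.
rewrite big_split /= sumrN -mulr_sumr -H.
rewrite big_const_seq count_predT size_unit_roots //.
rewrite iter_addr_0 -[_ ^+ M.-1 *+ M]mulr_natr.
have -> : a * (a ^+ M.-1 * M%:R / (a ^+ M - 1)) = a ^+ M * M%:R / (a ^+ M - 1).
  by rewrite !mulrA -exprS prednK.
by field; rewrite aM1 aM0 M0'.
Qed.

(** * Rouche's theorem for polynomials *)

(** The M-node trapezoidal sum for the integral of the argument principle. *)
Definition mean_logderiv (C : numClosedFieldType) (M : nat) (p : {poly C}) : C :=
  M%:R^-1 * \sum_(w <- unit_roots C M) w * (p^`().[w] / p.[w]).

(** The error of the trapezoidal sum is explicit: a root r contributes
    1 / (1 - r^M) in place of 1 or 0. *)
Lemma mean_logderivE (C : numClosedFieldType) (M : nat) (p : {poly C}) :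
  (0 < M)%N -> (forall w, `|w| = 1 -> p.[w] != 0) ->
  mean_logderiv M p = \sum_(r <- roots_of p) (1 - r ^+ M)^-1.
Proof.
move=> M0 pw; have p0 : p != 0.
  by apply: contraNneq (pw 1 (normr1 _)) => ->; rewrite horner0.
rewrite /mean_logderiv.
under eq_big_seq => w /(norm_unit_roots M0)/pw pw0.
  rewrite logderiv_roots // mulr_sumr; over.
rewrite exchange_big mulr_sumr; apply: eq_big_seq => r /=.
rewrite mem_roots_of // => /eqP pr; rewrite mean_unit_roots //.
apply/eqP => rM; have /pw : `|r| = 1.
  by apply/eqP; rewrite -(@pexpr_eq1 _ _ M) ?normr_ge0 // -normrX rM normr1.
by rewrite pr eqxx.
Qed.

Lemma inv_pow_near (R : realType) (r e : CC R) : `|r| != 1 -> 0 < e ->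
  exists N : nat, forall M, (N <= M)%N ->
    `|(1 - r ^+ M)^-1 - (`|r| < 1)%R%:R | <= e.
Proof.
(* Both cases reduce to u / (1 - u) with u a high power of r or of its inverse. *)
have small (u v : CC R) : 0 < v -> `|u| < v / (1 + v) ->
    `|u / (1 - u)| <= v.
  move=> v0 uv; have v10 : 0 < 1 + v by rewrite addr_gt0.
  have u1 : `|u| < 1.
    by apply: lt_trans uv _; rewrite ltr_pdivrMr // mul1r ltrDr ltr01.
  have nu : 0 < 1 - `|u| by rewrite subr_gt0.
  have nu' : 1 - `|u| <= `|1 - u| by rewrite -{1}[1](@normr1 (CC R)) lerB_dist.
  rewrite normrM normfV ler_pdivrMr; last exact: lt_le_trans nu'.
  apply: le_trans (ler_wpM2l (ltW v0) nu'); rewrite mulrBr mulr1 lerBrDr.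
  by move: uv; rewrite ltr_pdivlMr // mulrDr mulr1 [v * _]mulrC => /ltW.
move=> r1 e0; have d0 : 0 < e / (1 + e) by rewrite divr_gt0 // addr_gt0.
case: (boolP (`|r| < 1)) => [rlt|rge].
  have [N HN] := norm_pow_small rlt d0; exists N => M /HN HM.
  suff -> : (1 - r ^+ M)^-1 - true%:R = r ^+ M / (1 - r ^+ M) by exact: small.
  have : 1 - r ^+ M != 0.
    rewrite subr_eq0; apply: contraTneq HM => <-; rewrite normr1 lt_gtF //.
    by rewrite ltr_pdivrMr ?addr_gt0 // mul1r ltrDr ltr01.
  by move=> ?; rewrite /=; field.
have rgt : 1 < `|r|.
  by rewrite lt_def r1 /=; rewrite real_ltNge ?normr_real // negbK in rge.
have r0 : r != 0 by apply: contraTneq rgt => ->; rewrite normr0 ltr10.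
have rlt : `|r^-1| < 1 by rewrite normfV invf_lt1 // (lt_trans ltr01).
have [N HN] := norm_pow_small rlt d0; exists N => M /HN HM.
suff -> : (1 - r ^+ M)^-1 - false%:R = - (r^-1 ^+ M / (1 - r^-1 ^+ M)).
  by rewrite normrN; exact: small.
have rM : r ^+ M != 0 by rewrite expf_neq0.
have rM1 : 1 - r ^+ M != 0.
  rewrite subr_eq0; apply: contraTneq HM => H.
  rewrite exprVn -H invr1 normr1 lt_gtF //.
  by rewrite ltr_pdivrMr ?addr_gt0 // mul1r ltrDr ltr01.
rewrite exprVn subr0; field.
by rewrite rM1 rM -opprB oppr_eq0 rM1.
Qed.

Lemma sum_inv_pow_near (R : realType) (s : seq (CC R)) (e : CC R) :
  (forall r, r \in s -> `|r| != 1) -> 0 < e ->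
  exists N : nat, forall M, (N <= M)%N ->
   `|\sum_(r <- s) (1 - r ^+ M)^-1 - (count [pred r : CC R | (`|r| < 1)%R] s)%:R|
   <= e.
Proof.
elim: s e => [|r s IH] e H e0.
  by exists 0%N => M _; rewrite big_nil subrr normr0 ltW.
have e20 : 0 < e / 2 by rewrite divr_gt0.
have Hs x (xs : x \in s) := H x (@mem_behead _ (r :: s) x xs).
have [N1 H1] := IH _ Hs e20.
have [N2 H2] := inv_pow_near (H r (mem_head _ _)) e20.
exists (maxn N1 N2) => M; rewrite geq_max => /andP[/H1 h1 /H2 h2].
rewrite big_cons /= natrD opprD addrACA [e]splitr.
exact: le_trans (ler_normD _ _) (lerD h2 h1).
Qed.

Lemma mean_logderiv_near (R : realType) (p : {poly CC R}) (e : CC R) :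
  (forall w, `|w| = 1 -> p.[w] != 0) -> 0 < e ->
  exists N : nat, forall M, (N < M)%N ->
   `|mean_logderiv M p - (disc_roots p)%:R| <= e.
Proof.
move=> pw e0; have p0 : p != 0.
  by apply: contraNneq (pw 1 (normr1 _)) => ->; rewrite horner0.
have H r : r \in roots_of p -> `|r| != 1.
  by rewrite mem_roots_of // => /eqP pr; apply/eqP => /pw; rewrite pr eqxx.
have [N HN] := sum_inv_pow_near H e0; exists N => M NM.
by rewrite mean_logderivE ?HN // ?(ltnW NM) // (leq_ltn_trans _ NM).
Qed.

Lemma mean_logderiv_dist (C : numClosedFieldType) (M : nat) (p q : {poly C})
  (e : C) : (0 < M)%N ->
  (forall w, `|w| = 1 -> `|p^`().[w] / p.[w] - q^`().[w] / q.[w]| <= e) ->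
  `|mean_logderiv M p - mean_logderiv M q| <= e.
Proof.
move=> M0 H; rewrite /mean_logderiv -mulrBr -sumrB normrM normfV normr_nat.
rewrite ler_pdivrMl ?ltr0n // -[X in _ <= X](_ : \sum_(w <- unit_roots C M) e = _).
  apply: le_trans (ler_norm_sum _ _ _) _.
  rewrite big_seq [leRHS]big_seq; apply: ler_sum => w /(norm_unit_roots M0) w1.
  by rewrite -mulrBr normrM w1 mul1r H.
by rewrite big_const_seq count_predT size_unit_roots // iter_addr_0 mulr_natl.
Qed.

(** The two counts are integers at distance at most 1/2 + 1/8 + 1/8 < 1. *)
Lemma disc_roots_stable (R : realType) (p q : {poly CC R}) :
  (forall w, `|w| = 1 -> p.[w] != 0) -> (forall w, `|w| = 1 -> q.[w] != 0) ->
  (forall w, `|w| = 1 -> `|p^`().[w] / p.[w] - q^`().[w] / q.[w]| <= 2^-1) ->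
  disc_roots p = disc_roots q.
Proof.
move=> pw qw pq; have e0 : 0 < 8^-1 :> CC R by rewrite invr_gt0.
have [N1 H1] := mean_logderiv_near pw e0.
have [N2 H2] := mean_logderiv_near qw e0.
pose M := (maxn N1 N2).+1.
have {}H1 : `|mean_logderiv M p - (disc_roots p)%:R| <= 8^-1.
  by apply: H1; rewrite ltnS leq_maxl.
have {}H2 : `|mean_logderiv M q - (disc_roots q)%:R| <= 8^-1.
  by apply: H2; rewrite ltnS leq_maxr.
have H3 : `|mean_logderiv M p - mean_logderiv M q| <= 2^-1.
  exact: mean_logderiv_dist.
have : `|(disc_roots p)%:R - (disc_roots q)%:R : CC R| < 1.
  have -> : (disc_roots p)%:R - (disc_roots q)%:R =
     (mean_logderiv M p - mean_logderiv M q)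
     - (mean_logderiv M p - (disc_roots p)%:R)
     + (mean_logderiv M q - (disc_roots q)%:R) by ring.
  apply: le_lt_trans (ler_normD _ _) _.
  apply: le_lt_trans (lerD (ler_normB _ _) (lexx _)) _.
  apply: le_lt_trans (lerD (lerD H3 H1) H2) _.
  rewrite -[X in _ < X](_ : (2^-1 + 8^-1 + 8^-1 + 4^-1 : CC R) = 1); last by field.
  by rewrite ltrDl invr_gt0.
have -> : (disc_roots p)%:R - (disc_roots q)%:R =
    ((disc_roots p)%:Z - (disc_roots q)%:Z)%:~R :> CC R by rewrite intrB.
rewrite -intr_norm ltrz1 -abszE ltz_nat ltnS leqn0 absz_eq0 subr_eq0 => /eqP E.
by case: E.
Qed.

Lemma horner_circle_ub (C : numDomainType) (p : {poly C}) :
  exists2 K : C, 0 <= K & forall w, `|w| = 1 -> `|p.[w]| <= K.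
Proof.
exists (\sum_(i < size p) `|p`_i|); first by apply: sumr_ge0 => i _.
move=> w w1; rewrite horner_coef; apply: le_trans (ler_norm_sum _ _ _) _.
by apply: ler_sum => i _; rewrite normrM normrX w1 expr1n mulr1.
Qed.

Lemma horner_circle_lb (C : numClosedFieldType) (p : {poly C}) :
  (forall w, `|w| = 1 -> p.[w] != 0) ->
  exists2 d : C, 0 < d & forall w, `|w| = 1 -> d <= `|p.[w]|.
Proof.
move=> pw; have p0 : p != 0.
  by apply: contraNneq (pw 1 (normr1 _)) => ->; rewrite horner0.
have H r : r \in roots_of p -> `|r| != 1.
  by rewrite mem_roots_of // => /eqP pr; apply/eqP => /pw; rewrite pr eqxx.
exists (`|lead_coef p| * \prod_(r <- roots_of p) `|1 - `|r| |).
  rewrite mulr_gt0 ?normr_gt0 ?lead_coef_eq0 // big_seq prodr_gt0 // => r /H r1.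
  by rewrite normr_gt0 subr_eq0 eq_sym.
move=> w w1; rewrite [in leRHS](roots_ofE p) hornerZ normrM.
rewrite ler_wpM2l // horner_prod normr_prod; apply: ler_prod => r _.
by rewrite normr_ge0 hornerXsubC -w1 ler_dist_dist.
Qed.

(** Along the segment p - s q, the numerator of the difference of two
    logarithmic derivatives is (s - u) (p' q - q' p), while |p - s q| is at
    least (1 - |t|) |p|; equal small steps in s thus keep the count constant. *)
Lemma rouche (R : realType) (p q : {poly CC R}) (t : CC R) :
  (forall w, `|w| = 1 -> p.[w] != 0) ->
  (forall w, `|w| = 1 -> `|q.[w]| <= `|p.[w]|) -> `|t| < 1 ->
  disc_roots (p - t *: q) = disc_roots p.
Proof.
move=> pw qp t1.
have [d d0 dP] := horner_circle_lb pw.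
have [K K0 KP] := horner_circle_ub (p^`() * q - q^`() * p).
pose g := (1 - `|t|) * d.
have g0 : 0 < g by rewrite mulr_gt0 // subr_gt0.
pose N s := p - s *: q.
have NE s w : (N s).[w] = p.[w] - s * q.[w].
  by rewrite /N hornerD hornerN hornerZ.
have Nlb s w : `|s| <= `|t| -> `|w| = 1 -> g <= `|(N s).[w]|.
  move=> st w1; rewrite NE; apply: le_trans (lerB_dist _ _).
  rewrite normrM; have ptq : `|s| * `|q.[w]| <= `|t| * `|p.[w]|.
    by rewrite ler_pM // qp.
  apply: le_trans (lerB (lexx _) ptq); rewrite /g -[X in _ <= X - _]mul1r -mulrBl.
  by rewrite ler_wpM2l ?dP // subr_ge0 ltW.
have N0 s w : `|s| <= `|t| -> `|w| = 1 -> (N s).[w] != 0.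
  by move=> st w1; rewrite -normr_gt0 (lt_le_trans g0) ?Nlb.
have step s u : `|s| <= `|t| -> `|u| <= `|t| -> `|s - u| * K / g ^+ 2 <= 2^-1 ->
    disc_roots (N s) = disc_roots (N u).
  move=> st ut su; apply: disc_roots_stable => w w1; [exact: N0|exact: N0|].
  apply: le_trans su.
  have -> : (N s)^`().[w] / (N s).[w] - (N u)^`().[w] / (N u).[w] =
    (s - u) * (p^`() * q - q^`() * p).[w] / ((N s).[w] * (N u).[w]).
    have := N0 s w st w1; have := N0 u w ut w1; rewrite !NE => n1 n2.
    rewrite /N !derivB !derivZ !(hornerD, hornerN, hornerZ, hornerM).
    by field; rewrite n1 n2.
  rewrite normrM normfV normrM [`|_.[w] * _|]normrM; apply: ler_pM.
  - by rewrite mulr_ge0.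
  - by rewrite invr_ge0 mulr_ge0.
  - by rewrite ler_wpM2l // KP.
  rewrite lef_pV2 ?posrE; last 2 first.
  - by rewrite mulr_gt0 // normr_gt0 N0.
  - exact: exprn_gt0.
  by rewrite expr2 ler_pM ?Nlb // ltW.
have [L HL] := archi_CC (2 * K / g ^+ 2).
have B0 : 0 <= 2 * K / g ^+ 2.
  by apply: divr_ge0; [exact: mulr_ge0 | apply: exprn_ge0; exact: ltW].
pose sg (j : nat) : CC R := j%:R / L.+1%:R * t.
have sE j : (j <= L.+1)%N -> `|sg j| <= `|t|.
  move=> jL; rewrite /sg normrM ler_piMl // normrM normfV !normr_nat.
  by rewrite ler_pdivrMr ?ltr0n // mul1r ler_nat.
have main j : (j <= L.+1)%N -> disc_roots (N (sg j)) = disc_roots p.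
  elim: j => [_|j IH jL]; first by rewrite /N /sg !mul0r scale0r subr0.
  rewrite -(IH (ltnW jL)); apply: step; rewrite ?sE ?(ltnW jL) //.
  have -> : sg j.+1 - sg j = t / L.+1%:R.
    rewrite /sg -[j.+1]addn1 natrD -mulrBl -mulrBl addrAC subrr add0r.
    by rewrite div1r mulrC.
  rewrite normrM normfV normr_nat.
  have h1 : `|2 * K / g ^+ 2| <= L.+1%:R by rewrite (le_trans HL) // ler_nat.
  have h2 : 2 * K / g ^+ 2 <= L.+1%:R.
    by rewrite ger0_norm in h1.
  have h3 : `|t| * (2 * K / g ^+ 2) <= L.+1%:R.
    apply: le_trans h2; apply: ler_piMl (ltW t1).
    exact: B0.
  have -> : `|t| / L.+1%:R * K / g ^+ 2 =
    2^-1 * (`|t| * (2 * K / g ^+ 2) / L.+1%:R).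
    have l0 : L.+1%:R != 0 :> CC R by rewrite pnatr_eq0.
    move: (L.+1%:R) l0 => l l0.
    by field; rewrite l0 (gt_eqF g0).
  by rewrite ler_piMr ?invr_ge0 // ler_pdivrMr ?ltr0n // mul1r.
have := main L.+1 (leqnn _).
by rewrite /N /sg divff ?mul1r // pnatr_eq0.
Qed.

(** * Differentiation along the positive real axis *)

Lemma is_derive_horner (K : numFieldType) (p : {poly K}) (x : K) :
  is_derive x 1 (horner p) p^`().[x].
Proof.
elim/poly_ind: p => [|p c IH].
  rewrite deriv0 horner0 (_ : horner 0 = cst 0); first exact: is_derive_cst.
  by apply/funext => y; rewrite horner0.
rewrite (_ : horner (p * 'X + c%:P) = (horner p * id) + cst c); last first.
  by apply/funext => y; rewrite !hornerE.
apply: is_derive_eq.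
by rewrite derivD derivC addr0 derivM derivX mulr1 !hornerE addrC [_%:A]mulr1
  [_ *: _]mulrC.
Qed.

Lemma continuous_poly (K : numFieldType) (p : {poly K}) : continuous (horner p).
Proof.
move=> x; apply/differentiable_continuous/derivable1_diffP.
exact: (@ex_derive _ _ _ _ _ _ _ (is_derive_horner p x)).
Qed.

Lemma cvg_real_complex_right (R : realType) :
  (fun t : R => t%:C%C : CC R) @ 0^'+ --> (0 : CC R)^'.
Proof.
move=> P [e /= e0 eP]; have e0' : 0 < complex.Re e.
  by move: e0; rewrite ltcE => /andP[].
exists (complex.Re e) => //= t; rewrite /ball_ /= sub0r normrN => te t0.
apply: eP; last by rewrite /= eq_complex /= negb_and (gt_eqF t0).
rewrite /ball_ /= sub0r normrN.
have -> : e = (complex.Re e)%:C%C :> R[i] by rewrite RRe_real ?gtr0_real.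
by rewrite normc_def /= expr0n /= addr0 sqrtr_sqr ltcR.
Qed.

Lemma is_derive_Re (R : realType) (F : CC R -> CC R) (t : R) (dF : CC R) :
  is_derive (t%:C%C : CC R) 1 F dF ->
  is_derive t 1 (fun x : R => complex.Re (F x%:C%C)) (complex.Re dF).
Proof.
move=> [dv vE].
have H : (fun h : R => h^-1 *: (complex.Re (F (h *: 1 + t)%:C%C)
    - complex.Re (F t%:C%C))) @ 0^' --> complex.Re dF.
  move/cvg_ex: dv => [l Fl]; have ldF : l = dF by rewrite -vE; apply/esym/cvg_lim.
  rewrite ldF in Fl; apply/cvgrPdist_lt => e e0.
  have ec0 : 0 < (e%:C%C : CC R) by rewrite ltcR.
  have /cvgrPdist_lt/(_ _ ec0) [d /= d0 Hd] := Fl.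
  have d0' : 0 < complex.Re d by move: d0; rewrite ltcE => /andP[].
  exists (complex.Re d) => //= h; rewrite /ball_ /= sub0r normrN => hd h0.
  have /= := Hd h%:C%C.
  rewrite /ball_ /= sub0r normrN eq_complex /= eqxx andbT => /(_ _ h0).
  have dE : d = (complex.Re d)%:C%C :> R[i] by rewrite RRe_real ?gtr0_real.
  rewrite [X in _ < X]dE normc_def /= expr0n /= addr0 sqrtr_sqr ltcR.
  move=> /(_ hd) Hh; rewrite -ltcR; apply: le_lt_trans Hh.
  apply: le_trans (normc_ge_Re _); rewrite lecR.
  have -> : (h%:C%C : CC R) *: 1 + t%:C%C = (h *: 1 + t)%:C%C :> CC R.
    by rewrite [_ *: 1]mulr1 [h *: 1]mulr1 rmorphD.
  rewrite le_eqVlt; apply/orP; left; apply/eqP; congr (`|_|); rewrite -fmorphV.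
  case: dF {vE Fl ldF Hd} => u v.
  case: (F (h *: 1 + t)%:C%C) => a b; case: (F t%:C%C) => a' b' /=.
  by rewrite mul0r subr0.
split; last exact: cvg_lim H.
by apply/cvg_ex; exists (complex.Re dF).
Qed.

Lemma near_right_ex (R : realType) (P : R -> Prop) :
  (\forall t \near 0^'+, P t) ->
  exists2 d : R, 0 < d & forall t, 0 < t -> t < d -> P t.
Proof.
move=> [d /= d0 dP]; exists d => // t t0 td; apply: dP => //.
by rewrite /ball_ /= sub0r normrN gtr0_norm.
Qed.

Lemma derivable_segment_MVT (R : realType) (f df : R -> R) (a b : R) : a < b ->
  (forall x, a <= x <= b -> is_derive x 1 f (df x)) ->
  exists2 c, a < c < b & f b - f a = df c * (b - a).
Proof.
move=> ab H; have [||c] := @MVT R f df a b ab.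
- by move=> x; rewrite in_itv /= => /andP[ax xb]; apply: H; rewrite !ltW.
- apply: derivable_within_continuous => x; rewrite in_itv /= => /H dx.
  exact: ex_derive.
by rewrite in_itv; exists c.
Qed.

Lemma is_derive_rate (R : realType) (f : R -> R) (df : R) :
  is_derive (0 : R) (1 : R) f df ->
  forall e, 0 < e -> \forall t \near 0^'+, `|f t - f 0 - df * t| <= e * t.
Proof.
move=> [/cvg_ex[l fl] vE] e e0.
have lE : l = df by rewrite -vE; apply/esym/cvg_lim.
rewrite lE in fl; have /cvgrPdist_lt/(_ _ e0) [d /= d0 Hd] := fl.
exists d => //= t td t0; have := Hd t td (lt0r_neq0 t0).
rewrite /= addr0 [t *: 1]mulr1 [_ *: _]mulrC => /ltW.
have -> : f t - f 0 - df * t = - (df - (f t - f 0) / t) * t.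
  by field; rewrite gt_eqF.
by rewrite normrM normrN (gtr0_norm t0) ler_pM2r.
Qed.

(** Second differences at t, 2t, 3t of x g(x) give 2 g'(0) t^2 up to o(t^2);
    applying the mean value theorem once to x g(x) and once to w gives
    (w1 + c'(0)) t^2. *)
Lemma second_order_match (R : realType) (g c w dw : R -> R) (g2 c1 w1 : R) :
  is_derive (0 : R) (1 : R) g g2 -> is_derive (0 : R) (1 : R) c c1 ->
  (\forall t \near 0^'+, is_derive t (1 : R) (fun x => x * g x) (w t + c t)) ->
  (\forall t \near 0^'+, is_derive t (1 : R) w (dw t)) ->
  dw t @[t --> 0^'+] --> w1 ->
  2 * g2 = w1 + c1.
Proof.
move=> g2E c1E gE wE dwE; apply/eqP; rewrite -subr_eq0 -normr_le0.
apply/ler_addgt0Pl => e0 e0_gt0; rewrite addr0.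
(* The errors add up to 9 + 8 + 1 + 3 + 2 + 1 = 24 times e t. *)
pose e := e0 / 25; have e_gt0 : 0 < e by rewrite divr_gt0.
have dwe : \forall t \near 0^'+, `|w1 - dw t| <= e.
  by near do apply: ltW; have /cvgrPdist_lt := dwE; exact.
have [d d0 H] := near_right_ex (filterI gE (filterI wE (filterI dwe
  (filterI (is_derive_rate g2E e_gt0) (is_derive_rate c1E e_gt0))))).
pose t := d / 4.
have t0 : 0 < t by rewrite divr_gt0.
have td : 3 * t < d by rewrite /t; lra.
have [||xi /andP[txi xit] E1] := @derivable_segment_MVT R
  (fun x => (x + t) * g (x + t) - x * g x)
  (fun x => (w (x + t) + c (x + t)) - (w x + c x)) t (2 * t).
- lra.
- move=> x /andP[tx xt].
  have [||x0 _] := H x; [lra|lra|].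
  have [||xt0 _] := H (x + t); [lra|lra|].
  have xt1 : is_derive x 1 (fun y => (y + t) * g (y + t)) (w (x + t) + c (x + t)).
    have sh : is_derive x (1 : R) (fun y : R => y + t) 1.
      by apply: is_derive_eq; rewrite addr0.
    have := @is_derive1_comp R (fun y => y * g y) (fun y => y + t) x _ _ xt0 sh.
    by rewrite mulr1.
  exact: is_deriveB.
have [||eta /andP[xie etax] E2] := @derivable_segment_MVT R w dw xi (xi + t).
- lra.
- by move=> x /andP[tx xt]; have [||_ []] := H x; [lra|lra|].
have [||_ [_ [de _]]] := H eta; [lra|lra|].
have [||_ [_ [_ [g_1 _]]]] := H t; [lra|lra|].
have [||_ [_ [_ [g_2 _]]]] := H (2 * t); [lra|lra|].
have [||_ [_ [_ [g_3 _]]]] := H (3 * t); [lra|lra|].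
have [||_ [_ [_ [_ c_1]]]] := H xi; [lra|lra|].
have [||_ [_ [_ [_ c_2]]]] := H (xi + t); [lra|lra|].
move: E1 E2; rewrite (_ : 2 * t + t = 3 * t); last by ring.
rewrite (_ : t + t = 2 * t); last by ring.
rewrite (_ : 2 * t - t = t); last by ring.
rewrite (_ : xi + t - xi = t); last by ring.
move=> E1 E2.
set r1 := (X in `|X|) in g_1; set r2 := (X in `|X|) in g_2.
set r3 := (X in `|X|) in g_3; set s1 := (X in `|X|) in c_1.
set s2 := (X in `|X|) in c_2; set v := (X in `|X|) in de.
have key : t * (2 * g2 - (w1 + c1)) =
    - 3 * r3 + 4 * r2 - r1 + s2 - s1 - t * v.
  apply: (mulfI (lt0r_neq0 t0)).
  have wE2 : w (xi + t) = w xi + dw eta * t by rewrite -E2; ring.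
  have gE3 : 3 * t * g (3 * t) = 2 * t * g (2 * t) + 2 * t * g (2 * t) - t * g t
      + (dw eta * t + c (xi + t) - c xi) * t.
    have -> : dw eta * t = w (xi + t) - w xi by rewrite E2.
    have -> : (w (xi + t) - w xi + c (xi + t) - c xi) * t =
      (w (xi + t) + c (xi + t) - (w xi + c xi)) * t by ring.
    by rewrite -E1; ring.
  rewrite /r1 /r2 /s1 /s2 /v.
  have -> : t * (- 3 * r3 + 4 * (g (2 * t) - g 0 - g2 * (2 * t)) -
      (g t - g 0 - g2 * t) + (c (xi + t) - c 0 - c1 * (xi + t)) -
      (c xi - c 0 - c1 * xi) - t * (w1 - dw eta)) =
    - (3 * t * g (3 * t)) + 3 * t * g 0 + 9 * t ^+ 2 * g2 +
      t * (4 * (g (2 * t) - g 0 - g2 * (2 * t)) -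
      (g t - g 0 - g2 * t) + (c (xi + t) - c 0 - c1 * (xi + t)) -
      (c xi - c 0 - c1 * xi) - t * (w1 - dw eta)) by rewrite /r3; ring.
  by rewrite gE3; ring.
have tv : `|t * v| <= e * t by rewrite normrM gtr0_norm // mulrC ler_wpM2r // ltW.
have exi : e * xi <= 2 * (e * t) by rewrite mulrCA ler_pM2l // ltW.
have exit : e * (xi + t) <= 3 * (e * t) by rewrite mulrCA ler_pM2l //; lra.
rewrite -(ler_pM2l t0) -{1}(gtr0_norm t0) -normrM key.
have -> : t * e0 = 25 * (e * t) by rewrite /e; field.
have et0 : 0 < e * t by exact: mulr_gt0.
clearbody e t; clear -g_1 g_2 g_3 c_1 c_2 tv exi exit et0.
move: r1 r2 r3 s1 s2 (t * v) g_1 g_2 g_3 c_1 c_2 tv => r1 r2 r3 s1 s2 y.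
rewrite !ler_norml => /andP[? ?] /andP[? ?] /andP[? ?] /andP[? ?].
move=> /andP[? ?] /andP[? ?].
apply/andP; split; lra.
Unshelve. all: by end_near.
Qed.

(** * A linear equation singular at the origin *)

(** Pointwise forms of the differentiation rules, which compose by
    unification. *)
Lemma is_derive_mulr (K : numFieldType) (f g : K -> K) (x df dg : K) :
  is_derive x 1 f df -> is_derive x 1 g dg ->
  is_derive x 1 (fun y => f y * g y) (f x * dg + df * g x).
Proof.
move=> fE gE; have := is_deriveM fE gE.
by rewrite [g x *: df]mulrC.
Qed.

Lemma is_derive_addr (K : numFieldType) (f g : K -> K) (x df dg : K) :
  is_derive x 1 f df -> is_derive x 1 g dg ->
  is_derive x 1 (fun y => f y + g y) (df + dg).
Proof. exact: is_deriveD. Qed.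

Lemma is_derive_subr (K : numFieldType) (f g : K -> K) (x df dg : K) :
  is_derive x 1 f df -> is_derive x 1 g dg ->
  is_derive x 1 (fun y => f y - g y) (df - dg).
Proof. exact: is_deriveB. Qed.

Lemma is_derive_mull (K : numFieldType) (f : K -> K) (c x df : K) :
  is_derive x 1 f df -> is_derive x 1 (fun y => c * f y) (c * df).
Proof. by move=> fE; have := is_deriveZ c fE. Qed.

Lemma ReD (R : realType) (x y : CC R) :
  complex.Re (x + y) = complex.Re x + complex.Re y.
Proof. by case: x => a b; case: y. Qed.

Lemma ReZ (R : realType) (x : R) (y : CC R) :
  complex.Re (x%:C%C * y) = x * complex.Re y.
Proof. by case: y => a b /=; rewrite mul0r subr0. Qed.

Lemma near_dnbhs_real (R : realType) (P : CC R -> Prop) :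
  (\forall z \near (0 : CC R)^', P z) -> \forall t \near (0 : R)^'+, P t%:C%C.
Proof. exact: cvg_real_complex_right. Qed.

(** At a zero of D the equation D h'' = 2 A (h - z h') would give the result at
    once if h'' were bounded near 0.  Only first derivatives of h are used
    here: with D = z E, the function D h = z (E h) has derivative W + P h, where
    W = D h' - D' h + 2 z A h and P = 2 (D' - z A), and the equation turns W'
    into (4 A + 2 z A' - D'') h, which is continuous at 0.  Matching the
    coefficients of order 2 leaves 2 A(0) h(0) = 0. *)
Lemma singular_ode (R : realType) (h : CC R -> CC R) (A D : {poly CC R}) :
  (\forall z \near (0 : CC R), derivable h z 1) ->
  (\forall z \near (0 : CC R)^', derivable h^`()%classic z 1 /\
     D.[z] * h^`()%classic^`()%classic z =
       2 * A.[z] * (h z - z * h^`()%classic z)) ->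
  D.[0] = 0 -> A.[0] * h 0 = 0.
Proof.
move=> hE odeE D0; apply/eqP/negPn/negP => Ah0.
have [E DE] : exists E, D = E * 'X.
  have /factor_theorem[E ->] : root D 0 by rewrite rootE D0.
  by exists E; rewrite subr0.
(* Real parts suffice after normalizing A(0) h(0) to 1, by the factor k. *)
pose k := (A.[0] * h 0)^-1.
pose h' := h^`()%classic; pose h'' := h'^`()%classic.
pose P := 2%:P * (D^`() - 'X * A).
have hder z : derivable h z 1 -> is_derive z 1 h (h' z).
  by move=> /derivableP; rewrite /h' derive1E.
have h'der z : derivable h' z 1 -> is_derive z 1 h' (h'' z).
  by move=> /derivableP; rewrite /h'' derive1E.
have h0E := hder 0 (nbhs_singleton hE).
have pE (p : {poly CC R}) (z : CC R) := is_derive_horner p z.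
have := @second_order_match R
  (fun t => complex.Re (k * (E.[t%:C%C] * h t%:C%C)))
  (fun t => complex.Re (k * (P.[t%:C%C] * h t%:C%C)))
  (fun t => complex.Re (k * (D.[t%:C%C] * h' t%:C%C - D^`().[t%:C%C] * h t%:C%C
                 + 2 * t%:C%C * A.[t%:C%C] * h t%:C%C)))
  (fun t => complex.Re (k * ((4 * A.[t%:C%C] + 2 * t%:C%C * A^`().[t%:C%C]
                 - D^`()^`().[t%:C%C]) * h t%:C%C)))
  (complex.Re (k * (E.[0] * h' 0 + E^`().[0] * h 0)))
  (complex.Re (k * (P.[0] * h' 0 + P^`().[0] * h 0)))
  (complex.Re (k * ((4 * A.[0] - D^`()^`().[0]) * h 0))).
have prodE (p : {poly CC R}) : is_derive (0 : R) (1 : R)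
    (fun t => complex.Re (k * (p.[t%:C%C] * h t%:C%C)))
    (complex.Re (k * (p.[0] * h' 0 + p^`().[0] * h 0))).
  apply: (@is_derive_Re R (fun z => k * (p.[z] * h z))).
  exact: is_derive_mull (is_derive_mulr (pE p _) h0E).
move=> /(_ (prodE E) (prodE P)) match_coef.
have hR := near_dnbhs_real (nbhs_dnbhs hE).
have odeR := near_dnbhs_real odeE.
unshelve epose proof (concl := match_coef _ _ _).
- near=> t.
  have ht : is_derive (t%:C%C : CC R) 1 h (h' t%:C%C).
    by apply: hder; near: t.
  have := is_derive_Re (is_derive_mull k (is_derive_mulr (pE D _) ht)).
  rewrite (_ : (fun x => _) = (fun x => x * complex.Re (k * (E.[x%:C%C] * h x%:C%C)))).
    rewrite -ReD; move/is_derive_eq; apply; congr complex.Re.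
    rewrite /P !(hornerM, hornerD, hornerN, hornerC, hornerX).
    ring.
  apply/funext => x; rewrite -ReZ DE hornerM hornerX; congr complex.Re.
  ring.
- near=> t.
  have ht : is_derive (t%:C%C : CC R) 1 h (h' t%:C%C).
    by apply: hder; near: t.
  have [h't ode] : is_derive (t%:C%C : CC R) 1 h' (h'' t%:C%C) /\
      D.[t%:C%C] * h'' t%:C%C = 2 * A.[t%:C%C] * (h t%:C%C - t%:C%C * h' t%:C%C).
    suff [dh oE] : derivable h' t%:C%C 1 /\ 
      D.[t%:C%C] * h'' t%:C%C = 2 * A.[t%:C%C] * (h t%:C%C - t%:C%C * h' t%:C%C).
      by split; [exact: h'der | exact: oE].
    by near: t.
  have := is_derive_Re (is_derive_mull k (is_derive_addr
    (is_derive_subr (is_derive_mulr (pE D _) h't)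
      (is_derive_mulr (pE D^`() _) ht))
    (is_derive_mulr (is_derive_mulr (is_derive_mull 2 (is_derive_id _ _)) (pE A _)) ht))).
  move/is_derive_eq; apply; congr complex.Re; rewrite ode.
  ring.
- pose Q := 4%:P * A + 2%:P * 'X * A^`() - D^`()^`() : {poly CC R}.
  have QE z : Q.[z] = 4 * A.[z] + 2 * z * A^`().[z] - D^`()^`().[z].
    by rewrite /Q !(hornerM, hornerD, hornerN, hornerC, hornerX).
  have [/derivable1_diffP/differentiable_continuous Qc _] := prodE Q.
  have := cvg_at_right_filter Qc.
  rewrite QE mulr0 mul0r addr0.
  by under eq_fun do rewrite QE.
pose X := k * (E.[0] * h' 0 + E^`().[0] * h 0).
suff : complex.Re (X + X) = complex.Re (X + X + 2 * (k * (A.[0] * h 0))).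
  rewrite (ReD (X + X)) -[LHS]addr0 => /addrI; rewrite /k mulVf // mulr1 => /eqP.
  by rewrite -[2](rmorph_nat (real_complex R)) eq_sym pnatr_eq0.
transitivity (2 * complex.Re X); first by rewrite ReD mulr_natl mulr2n.
rewrite [LHS]concl -ReD; congr complex.Re.
have D1 : D^`().[0] = E.[0].
  by rewrite DE derivM derivX mulr1 hornerD hornerM hornerX mulr0 add0r.
have D2 : D^`()^`().[0] = 2 * E^`().[0].
  rewrite DE derivM derivX mulr1 derivD derivM derivX mulr1.
  rewrite !hornerD hornerM hornerX.
  ring.
have P0 : P.[0] = 2 * E.[0].
  by rewrite hornerM hornerC hornerD hornerN hornerM hornerX mul0r subr0 D1.
have P1 : P^`().[0] = 2 * (2 * E^`().[0] - A.[0]).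
  rewrite derivM derivC mul0r add0r hornerM hornerC derivB hornerD hornerN.
  by rewrite D2 derivM derivX mul1r hornerD hornerM hornerX mul0r addr0.
rewrite P0 P1 D2 /X.
ring.
Unshelve. all: by end_near.
Qed.

(** * The representation at the pole *)

Lemma near_dnbhs_join (R : realType) (x : CC R) (P : CC R -> Prop) :
  (\forall z \near x^', P z) -> \forall z \near x^', \forall y \near z, P y.
Proof.
rewrite !near_withinE => /near_join; apply: filterS => z Hz zx.
have zx' : \forall y \near z, y != x.
  exists `|z - x| => [|y /=]; first by rewrite /= normr_gt0 subr_eq0.
  by apply: contraTneq => ->; rewrite ltxx.
by apply: filterS2 zx' Hz => y yx; apply.
Qed.

(** A divergent difference quotient has the default limit 0. *)
Lemma derive1_neq0_derivable (R : realType) (g : CC R -> CC R) (z : CC R) :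
  g^`()%classic z != 0 -> derivable g z 1.
Proof.
move=> g0; apply: contrapT => ng; move/eqP: g0; apply.
rewrite derive1E; apply: (@getPN (CC R)) => l gl.
by apply: ng; apply/cvg_ex; exists l.
Qed.

Lemma clear_denominators (K : fieldType) (z A B df ddf : K) :
  B != 0 -> df != 0 -> z ^+ 2 * A / B - 1 != 0 ->
  z * (ddf / df) = 2 / (z ^+ 2 * A / B - 1) ->
  z * ddf * (z ^+ 2 * A - B) = 2 * B * df.
Proof.
move=> B0 df0 g0 E.
have -> : z * ddf = z * (ddf / df) * df by rewrite mulrA divfK.
have -> : z ^+ 2 * A - B = (z ^+ 2 * A / B - 1) * B.
  by rewrite mulrBl mul1r divfK.
by rewrite E; move: (_ / B - 1) g0 => g g0; field.
Qed.

(** At a simple pole of f the residue of f' is 0, so z f''/f' + 2 vanishes to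
    order 2 there, and with it g = z^2 A / B; as A(0) is nonzero, so is B(0). *)
Lemma pole_zero_free (R : realType) (f : CC R -> CC R) (A B : {poly CC R}) :
  has_order f 0 (- 1) ->
  (\forall z \near (0 : CC R)^', [/\ derivable f z 1, B.[z] != 0,
     z ^+ 2 * A.[z] / B.[z] - 1 != 0 &
     z * (f^`()%classic^`()%classic z / f^`()%classic z) =
       2 / (z ^+ 2 * A.[z] / B.[z] - 1)]) ->
  A.[0] != 0 -> B.[0] != 0.
Proof.
move=> [h [hder h0 fh]] fE A0; apply/negP => /eqP B0.
pose f' := f^`()%classic; pose f'' := f'^`()%classic.
pose h' := h^`()%classic; pose h'' := h'^`()%classic.
suff : A.[0] * h 0 = 0 by move/eqP; rewrite mulf_eq0 (negbTE A0) (negbTE h0).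
(* The function h of [has_order] is z f off 0, and it satisfies the singular
   equation of [singular_ode]. *)
apply: (@singular_ode R h A (B - 'X^2 * A)) => //; last first.
  by rewrite hornerD hornerN hornerM hornerXn expr0n mul0r subr0.
have hf : \forall z \near (0 : CC R)^', z * f z = h z.
  near=> z; have z0 : z != 0 by near: z; exact: nbhs_dnbhs_neq.
  have -> : f z = (z - 0) ^ (- 1) * h z by near: z.
  by rewrite subr0 mulrA mulfV // mul1r.
have h'f : \forall z \near (0 : CC R)^', f z + z * f' z = h' z.
  near=> z.
  have /derivableP fz : derivable f z 1.
    near: z; by apply: filterS fE => z [].
  rewrite /h' derive1E.
  have hz : \forall y \near z, y * f y = h y.
    near: z; exact: near_dnbhs_join hf.
  rewrite -(near_eq_derive _ hz).
  have := is_derive_mulr (is_derive_id z 1) fz.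
  move=> [_ ->]; rewrite /f' derive1E.
  by rewrite mul1r addrC.
near=> z.
have [fz Bz gz ode] : [/\ derivable f z 1, B.[z] != 0,
     z ^+ 2 * A.[z] / B.[z] - 1 != 0 &
     z * (f'' z / f' z) = 2 / (z ^+ 2 * A.[z] / B.[z] - 1)] by near: z.
have z0 : z != 0 by near: z; exact: nbhs_dnbhs_neq.
have ode0 : z * (f'' z / f' z) != 0.
  by rewrite ode mulf_neq0 ?invr_neq0 // pnatr_eq0.
have f'0 : f' z != 0.
  by apply: contraNneq ode0 => ->; rewrite invr0 !mulr0.
(* The representation makes f'' nonzero, so f' is differentiable at z. *)
have f''0 : f'' z != 0.
  by apply: contraNneq ode0 => ->; rewrite mul0r mulr0.
have h'z : \forall y \near z, f y + y * f' y = h' y.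
  near: z; exact: near_dnbhs_join h'f.
have f'z : is_derive z 1 f' (f'' z).
  by have /derivableP := derive1_neq0_derivable f''0; rewrite /f'' derive1E.
have fz' : is_derive z 1 f (f' z).
  by move/derivableP: fz; rewrite /f' derive1E.
have [dh' h''z] := near_eq_is_derive h'z
  (is_derive_addr fz' (is_derive_mulr (is_derive_id z 1) f'z)).
split; first exact: dh'.
have -> : h^`()%classic^`()%classic z = f' z + (z * f'' z + 1 * f' z).
  by rewrite derive1E h''z.
have -> : h z = z * f z by rewrite (near hf z).
have -> : h^`()%classic z = f z + z * f' z by rewrite (near h'f z).
rewrite hornerD hornerN hornerM hornerXn.
have := clear_denominators Bz f'0 gz ode.
rewrite -/f' -/f''.
move: (f'' z) (f' z) (f z) A.[z] B.[z] => d2 d1 d0 Az Bz' ode'.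
transitivity (2 * (Bz' - z ^+ 2 * Az) * d1 -
   z * d2 * (z ^+ 2 * Az - Bz')); first by ring.
by rewrite ode'; ring.
Unshelve. all: by end_near.
Qed.

(** * Finite Blaschke products as quotients of polynomials *)

Definition blaschke_num (C : numClosedFieldType) (s : seq C) : {poly C} :=
  \prod_(a <- s) ('X - a%:P).

Definition blaschke_den (C : numClosedFieldType) (s : seq C) : {poly C} :=
  \prod_(a <- s) (1 - a^* *: 'X).

Lemma horner_blaschke_den (C : numClosedFieldType) (s : seq C) (z : C) :
  (blaschke_den s).[z] = \prod_(a <- s) (1 - a^* * z).
Proof.
rewrite /blaschke_den horner_prod; apply: eq_bigr => a _.
by rewrite hornerD hornerN hornerZ hornerX hornerC.
Qed.

Lemma horner_blaschke_num (C : numClosedFieldType) (s : seq C) (z : C) :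
  (blaschke_num s).[z] = \prod_(a <- s) (z - a).
Proof.
by rewrite /blaschke_num horner_prod; apply: eq_bigr => a _; rewrite hornerXsubC.
Qed.

Lemma blaschke_den_neq0 (C : numClosedFieldType) (s : seq C) (z : C) :
  (forall a, a \in s -> `|a| < 1) -> `|z| <= 1 -> (blaschke_den s).[z] != 0.
Proof.
move=> s1 z1; rewrite horner_blaschke_den prodf_seq_neq0.
apply/allP => a /s1 a1 /=; rewrite subr_eq0; apply/negP => /eqP E.
have : `|a^* * z| < 1.
  by rewrite normrM norm_conjC; apply: le_lt_trans a1; rewrite ler_piMr.
by rewrite -E normr1 ltxx.
Qed.

Lemma blaschke_num_neq0 (C : numClosedFieldType) (s : seq C) (w : C) :
  (forall a, a \in s -> `|a| < 1) -> `|w| = 1 -> (blaschke_num s).[w] != 0.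
Proof.
move=> s1 w1; rewrite horner_blaschke_num prodf_seq_neq0.
apply/allP => a /s1 a1 /=; rewrite subr_eq0; apply: contraTneq a1 => <-.
by rewrite w1 ltxx.
Qed.

(** On the circle 1 - a^* w = w (w - a)^*. *)
Lemma norm_blaschke_circle (C : numClosedFieldType) (s : seq C) (w : C) :
  `|w| = 1 -> `|(blaschke_num s).[w]| = `|(blaschke_den s).[w]|.
Proof.
move=> w1; rewrite horner_blaschke_den horner_blaschke_num !normr_prod.
apply: eq_bigr => a _.
have -> : 1 - a^* * w = w * (w - a)^*.
  by rewrite rmorphB mulrBr -normCK w1 expr1n [w * _]mulrC.
by rewrite normrM w1 mul1r norm_conjC.
Qed.

Lemma disc_roots_blaschke_num (C : numClosedFieldType) (s : seq C) :
  (forall a, a \in s -> `|a| < 1) -> disc_roots (blaschke_num s) = size s.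
Proof.
by move=> s1; rewrite disc_roots_prod; apply/eqP; rewrite -all_count; apply/allP.
Qed.

Lemma disc_roots_blaschke_den (C : numClosedFieldType) (s : seq C) :
  (forall a, a \in s -> `|a| < 1) -> disc_roots (blaschke_den s) = 0%N.
Proof.
move=> s1; have H z : `|z| < 1 -> (blaschke_den s).[z] != 0.
  by move=> /ltW; exact: blaschke_den_neq0.
apply: disc_roots_eq0 => //.
have := H 0; rewrite normr0 ltr01 => /(_ isT).
by apply: contraNneq => ->; rewrite horner0.
Qed.

Lemma finite_blaschke_poly (R : realType) (d : nat) (B : CC R -> CC R) :
  finite_blaschke d B -> exists (c : CC R) (s : seq (CC R)),
  [/\ `|c| = 1, size s = d, forall a, a \in s -> `|a| < 1 &
    forall z, `|z| < 1 -> B z = c * (blaschke_num s).[z] / (blaschke_den s).[z]].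
Proof.
move=> [theta [a [a1 BE]]].
exists (cos theta +i* sin theta)%C, [seq a j | j <- enum 'I_d]; split.
- by rewrite normc_def /= cos2Dsin2 sqrtr1.
- by rewrite size_map size_enum_ord.
- by move=> _ /mapP[j _ ->]; exact: a1.
have bigE (F : CC R -> CC R) :
    \prod_(b <- [seq a j | j <- enum 'I_d]) F b = \prod_(j < d) F (a j).
  by rewrite big_map big_enum.
move=> z z1; rewrite (BE z z1) horner_blaschke_num horner_blaschke_den !bigE.
by rewrite -mulrA -prodf_div.
Qed.

(** * Meromorphic values and multiplicities of a rational function *)

Lemma near_poly_neq0 (K : numFieldType) (p : {poly K}) (z0 : K) :
  p.[z0] != 0 -> \forall z \near z0, p.[z] != 0.
Proof.
move=> p0; have /cvgrPdist_lt/(_ `|p.[z0]|) := @continuous_poly K p z0.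
rewrite normr_gt0 => /(_ p0); apply: filterS => z.
by apply: contraTneq => ->; rewrite subr0 ltxx.
Qed.

Lemma near_dnbhs_poly_neq0 (K : numFieldType) (p : {poly K}) (z0 : K) :
  p != 0 -> \forall z \near z0^', p.[z] != 0.
Proof.
move=> p0; have [m [q]] := multiplicity_XsubC p z0.
rewrite p0 /= => /near_poly_neq0 q0 ->.
near=> z; rewrite hornerM horner_exp hornerXsubC mulf_neq0 //.
  by near: z; exact: nbhs_dnbhs q0.
by rewrite expf_neq0 // subr_eq0; near: z; exact: nbhs_dnbhs_neq.
Unshelve. all: by end_near.
Qed.

(** At a root of Q, a finite limit l of g would give P(z0) = l Q(z0) = 0. *)
Lemma mero_value_rational (R : realType) (g : CC R -> CC R) (P Q : {poly CC R})
  (z0 : CC R) :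
  (\forall z \near z0^', g z = P.[z] / Q.[z]) ->
  Q != 0 -> ~ (P.[z0] = 0 /\ Q.[z0] = 0) ->
  mero_value g z0 = if Q.[z0] == 0 then None else Some (P.[z0] / Q.[z0]).
Proof.
move=> gE Qn0 PQ; rewrite /mero_value.
have polyc (p : {poly CC R}) : p.[z] @[z --> z0^'] --> p.[z0].
  by move=> A /(@continuous_poly _ p z0); exact: nbhs_dnbhs.
case: eqP => Q0; last first.
  have Q0' : Q.[z0] != 0 by apply/eqP.
  have gl : g z @[z --> z0^'] --> P.[z0] / Q.[z0].
    apply: cvg_trans (cvgM (polyc P) (cvgV Q0' (polyc Q))).
    apply: near_eq_cvg; apply: filterS gE => z zE; exact: esym.
  have -> : `[< cvg (g z @[z --> z0^']) >] = true.
    by apply/asboolP/cvg_ex; exists (P.[z0] / Q.[z0]).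
  by congr Some; exact: cvg_lim.
case: asboolP => // /cvg_ex[l gl]; exfalso; apply: PQ; split=> //.
have QP : g z * Q.[z] @[z --> z0^'] --> P.[z0].
  apply: cvg_trans (polyc P); apply: near_eq_cvg.
  apply: filterS2 gE (near_dnbhs_poly_neq0 z0 Qn0) => z -> Qz.
  by rewrite divfK.
have gQ : g z * Q.[z] @[z --> z0^'] --> (0 : CC R).
  have := cvgM gl (polyc Q); rewrite Q0 mulr0 => gQ.
  exact: gQ.
exact: norm_cvg_unique QP gQ.
Qed.

Lemma order_factor (C : numClosedFieldType) (p : {poly C}) (z : C) : p != 0 ->
  exists q, q.[z] != 0 /\
    p = ('X - z%:P) ^+ count_mem z (roots_of p) * q.
Proof.
move=> p0; exists (lead_coef p *: \prod_(r <- roots_of p | r != z) ('X - r%:P)).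
split.
  rewrite hornerZ mulf_neq0 ?lead_coef_eq0 // horner_prod prodf_seq_neq0.
  apply/allP => r _; apply/implyP => rz.
  by rewrite hornerXsubC subr_eq0 eq_sym.
rewrite [LHS]roots_ofE -scalerAr; congr (_ *: _).
rewrite (bigID (pred1 z)) /=; congr (_ * _).
rewrite (eq_bigr (fun=> 'X - z%:P)) => [|r /eqP -> //].
by rewrite big_const_seq iter_mulr_1.
Qed.

Lemma disc_roots_sum (C : numClosedFieldType) (p : {poly C}) :
  (\sum_(z <- undup [seq r <- roots_of p | (`|r| < 1)%R])
     count_mem z (roots_of p))%N = disc_roots p.
Proof.
set s := [seq r <- roots_of p | (`|r| < 1)%R].
have -> : disc_roots p = size s by rewrite size_filter.
transitivity (\sum_(z <- undup s) count_mem z s)%N.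
  apply: eq_big_seq => z; rewrite mem_undup mem_filter => /andP[z1 _].
  rewrite count_filter; apply: eq_count => r /=.
  by case: eqP => // ->; rewrite z1.
rewrite -(perm_size (perm_count_undup s)) size_flatten /shape -map_comp.
rewrite sumnE big_map; apply: eq_bigr => z _ /=.
by rewrite size_nseq.
Qed.

Lemma near_disc (R : realType) (z : CC R) : `|z| < 1 ->
  \forall x \near z, `|x| < 1.
Proof.
move=> z1; exists (1 - `|z|) => [|x /=]; first by rewrite /= subr_gt0.
rewrite ltrBrDr; apply: le_lt_trans.
by rewrite distrC -{1}(subrK z x) ler_normD.
Qed.

Lemma derivable_rational (R : realType) (P Q : {poly CC R}) (z : CC R) :
  Q.[z] != 0 -> derivable (fun x => P.[x] / Q.[x]) z 1.
Proof.
move=> Qz; have pE (p : {poly CC R}) := @ex_derive _ _ _ _ _ _ _ (is_derive_horner p z).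
by apply: derivableM; [exact: pE | apply: derivableV; [exact: Qz | exact: pE]].
Qed.

(** Since Q does not vanish at a root of P - b Q, the function
    P / Q - b = (P - b Q) / Q has there the order of that root. *)
Lemma nb_solutions_rational (R : realType) (F : CC R -> sphere R)
  (P Q : {poly CC R}) (b : CC R) :
  (forall z, `|z| < 1 ->
     F z = if Q.[z] == 0 then None else Some (P.[z] / Q.[z])) ->
  (forall z, `|z| < 1 -> ~ (P.[z] = 0 /\ Q.[z] = 0)) ->
  P - b *: Q != 0 ->
  nb_solutions F (@disc R) b (disc_roots (P - b *: Q)).
Proof.
move=> FE PQ; set N := P - b *: Q => N0.
have NE z : N.[z] = P.[z] - b * Q.[z] by rewrite hornerD hornerN hornerZ.
exists (undup [seq r <- roots_of N | `|r| < 1]), (fun z => count_mem z (roots_of N)).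
have sE z : z \in undup [seq r <- roots_of N | `|r| < 1] ->
    [/\ `|z| < 1, N.[z] = 0 & Q.[z] != 0].
  rewrite mem_undup mem_filter mem_roots_of // => /andP[z1 /eqP Nz]; split=> //.
  apply/negP => /eqP Qz; apply: (PQ z z1); split=> //.
  by move: Nz; rewrite NE Qz mulr0 subr0.
split; [exact: undup_uniq | | | exact: disc_roots_sum].
- move=> z; split=> [/sE[z1 Nz Qz]|[z1]].
    split=> //; rewrite FE // (negbTE Qz); congr Some.
    move/eqP: Nz; rewrite NE subr_eq0 => /eqP ->.
    by rewrite mulfK.
  rewrite FE //; case: eqP => // /eqP Qz [Pb].
  rewrite mem_undup mem_filter mem_roots_of // z1 NE -Pb divfK //.
  by rewrite subrr eqxx.
move=> z /sE[z1 Nz Qz]; have [q [qz Nq]] := order_factor z N0.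
exists (fun x => q.[x] / Q.[x]); split.
- apply: filterS (near_poly_neq0 Qz) => x; exact: derivable_rational.
- by rewrite mulf_neq0 // invr_neq0.
apply: nbhs_dnbhs.
apply: filterS2 (near_disc z1) (near_poly_neq0 Qz) => x x1 Qx.
rewrite /fin FE // (negbTE Qx) /= -exprnP.
have -> : P.[x] / Q.[x] - b = N.[x] / Q.[x].
  by rewrite NE mulrBl mulfK.
by rewrite [in LHS]Nq hornerM horner_exp hornerXsubC mulrA.
Qed.

(** * The pole function *)

Lemma pole_function_quotient (K : fieldType) (z g df ddf : K) :
  (2 : K) != 0 -> g - 1 != 0 -> z * (ddf / df) = 2 / (g - 1) ->
  z + 2 * (df / ddf) = z * g.
Proof.
move=> two0 g1 E; have zq0 : z * (ddf / df) != 0 by rewrite E mulf_neq0 ?invr_neq0.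
have z0 : z != 0 by apply: contraNneq zq0 => ->; rewrite mul0r.
have -> : df / ddf = z / (z * (ddf / df)).
  by rewrite invfM mulrA mulfV // mul1r invf_div.
rewrite E; move: g1; have -> : g = (g - 1) + 1 by rewrite subrK.
move: (g - 1) => u; rewrite addrK => u0.
by field; rewrite two0 u0.
Qed.

(** Holds also where factors vanish, since inversion maps 0 to 0. *)
Lemma blaschke_quotient (K : fieldType) (ck cm nk dk nm dm : K) :
  ck * nk / dk / (cm * nm / dm) = ck / cm * (nk * dm) / (nm * dk).
Proof. by rewrite !invfM invrK; ring. Qed.

(** The pole function is z g with g = z^2 Bk / Bm.  The factor z^3 cancels
    nothing in B because the simple pole of f keeps B(0) away from 0. *)
Lemma pole_function_blaschke (R : realType) (f : CC R -> sphere R)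
  (Bk Bm : CC R -> CC R) (c : CC R) (sk sm : seq (CC R)) :
  let A := c *: (blaschke_num sk * blaschke_den sm) in
  let B := blaschke_num sm * blaschke_den sk in
  (forall z, disc z -> z != 0 -> derivable (fin f) z 1) ->
  has_order (fin f) 0 (- 1) ->
  (forall z, `|z| < 1 -> Bk z / Bm z = A.[z] / B.[z]) ->
  (forall z, `|z| < 1 -> ~ (A.[z] = 0 /\ B.[z] = 0)) ->
  B != 0 ->
  blaschke_representation f Bk Bm ->
  (forall z, `|z| < 1 -> ~ (('X^3 * A).[z] = 0 /\ B.[z] = 0)) /\
  (forall z, `|z| < 1 -> pole_function f z =
     if B.[z] == 0 then None else Some (('X^3 * A).[z] / B.[z])).
Proof.
move=> A B fder f_pole BE AB Bn0 rep.
have X3 z : ('X^3 * A).[z] = z ^+ 3 * A.[z] by rewrite hornerM hornerXn.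
have repE z0 : `|z0| < 1 -> \forall z \near z0^',
    z ^+ 2 * A.[z] / B.[z] - 1 != 0 /\
    z * ((fin f)^`()%classic^`()%classic z / (fin f)^`()%classic z) =
      2 / (z ^+ 2 * A.[z] / B.[z] - 1).
  move=> z1; apply: filterS2 (nbhs_dnbhs (near_disc z1)) (rep z0 z1) => z zd.
  by rewrite -!mulrA BE.
have B0 : B.[0] != 0.
  have lt01 : `|0 : CC R| < 1 by rewrite normr0.
  apply/negP => /eqP B0; have A0 : A.[0] != 0.
    by apply/negP => /eqP A0; apply: (AB 0 lt01).
  suff : B.[0] != 0 by rewrite B0 eqxx.
  apply: (pole_zero_free f_pole _ A0).
  have z1 := nbhs_dnbhs (near_disc lt01).
  near=> z; have zd : disc z by near: z.
  have z0 : z != 0 by near: z; exact: nbhs_dnbhs_neq.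
  have Bz : B.[z] != 0 by near: z; exact: near_dnbhs_poly_neq0.
  have [g1 ode] : z ^+ 2 * A.[z] / B.[z] - 1 != 0 /\
    z * ((fin f)^`()%classic^`()%classic z / (fin f)^`()%classic z) =
      2 / (z ^+ 2 * A.[z] / B.[z] - 1) by near: z; exact: repE.
  split; [exact: fder | exact: Bz | exact: g1 | exact: ode].
have X3B z : `|z| < 1 -> ~ (('X^3 * A).[z] = 0 /\ B.[z] = 0).
  move=> z1 [/eqP + Bz]; rewrite X3 mulf_eq0 expf_eq0 /= => /orP[/eqP z0|/eqP Az].
    by move/eqP: Bz; rewrite z0 (negbTE B0).
  exact: (AB z z1).
split=> // z0 z1; rewrite /pole_function (@mero_value_rational R _ ('X^3 * A) B) //.
- apply: filterS (repE z0 z1) => z [g1 ode].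
  have two0 : (2 : CC R) != 0 by rewrite pnatr_eq0.
  by rewrite (pole_function_quotient two0 g1 ode) X3 (exprS z 2) -!mulrA.
- exact: X3B.
Unshelve. all: by end_near.
Qed.

Unset Implicit Arguments.

Theorem theorem4p14 (R : realType) (n k m : nat) (w : 'I_n.+2 -> CC R)
  (f : CC R -> sphere R) (Bk Bm : CC R -> CC R)
  (hw : simple_polygon w)
  (hf : conformal_onto_exterior f (closed_polygon w))
  (hBk : finite_blaschke k Bk)
  (hBm : finite_blaschke m Bm)
  (hcop : forall z, disc z -> ~ (Bk z = 0 /\ Bm z = 0))
  (hrep : blaschke_representation f Bk Bm) :
  (forall b : CC R, 1 < `|b| ->
     nb_solutions (pole_function f) (@disc R) b m) /\
  (forall a : CC R, `|a| < 1 ->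
     nb_solutions (pole_function f) (@disc R) a (k + 3)%N).
Proof.
have [fder [f0 f_pole] _ _] := hf.
have [ck [sk [ck1 <- sk1 BkE]]] := finite_blaschke_poly hBk.
have [cm [sm [cm1 <- sm1 BmE]]] := finite_blaschke_poly hBm.
pose c := ck / cm.
pose nk := blaschke_num sk; pose dk := blaschke_den sk.
pose nm := blaschke_num sm; pose dm := blaschke_den sm.
have ck0 : ck != 0 by rewrite -normr_eq0 ck1 oner_eq0.
have cm0 : cm != 0 by rewrite -normr_eq0 cm1 oner_eq0.
have c0 : c != 0 by rewrite mulf_neq0 ?invr_neq0.
have c1 : `|c| = 1 by rewrite normrM normfV ck1 cm1 divr1.
have circle_neq0 (p : {poly CC R}) :
    (forall u : CC R, `|u| = 1 -> p.[u] != 0) -> p != 0.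
  by move=> /(_ 1 (normr1 _)); apply: contraNneq => ->; rewrite horner0.
have dkC u : `|u| <= 1 -> dk.[u] != 0 by exact: blaschke_den_neq0.
have dmC u : `|u| <= 1 -> dm.[u] != 0 by exact: blaschke_den_neq0.
have nkC u : `|u| = 1 -> nk.[u] != 0 by exact: blaschke_num_neq0.
have nmC u : `|u| = 1 -> nm.[u] != 0 by exact: blaschke_num_neq0.
pose A := c *: (nk * dm); pose B := nm * dk; pose Q := 'X^3 * A.
have BC u : `|u| = 1 -> B.[u] != 0.
  by move=> u1; rewrite hornerM mulf_neq0 ?nmC ?dkC ?u1.
have QB u : `|u| = 1 -> `|Q.[u]| = `|B.[u]|.
  move=> u1; rewrite [Q.[u]]hornerM hornerXn normrM normrX u1 expr1n mul1r.
  rewrite hornerZ normrM c1 mul1r !hornerM !normrM.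
  by rewrite !norm_blaschke_circle // mulrC.
have QC u : `|u| = 1 -> Q.[u] != 0.
  by move=> u1; rewrite -normr_eq0 QB // normr_eq0 BC.
have BE z : `|z| < 1 -> Bk z / Bm z = A.[z] / B.[z].
  by move=> z1; rewrite BkE // BmE // blaschke_quotient hornerZ !hornerM.
clearbody c.
have AB z : `|z| < 1 -> ~ (A.[z] = 0 /\ B.[z] = 0).
  move=> z1 [/eqP Az /eqP Bz]; apply: (hcop z z1).
  have dk0 := dkC z (ltW z1); have dm0 := dmC z (ltW z1).
  move: Az Bz; rewrite hornerZ !hornerM !mulf_eq0 (negbTE c0) (negbTE dk0).
  rewrite (negbTE dm0) /= !orbF => /eqP nk0 /eqP nm0.
  by rewrite BkE // BmE // nk0 nm0 !mulr0 !mul0r.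
have [X3B PE] :=
  pole_function_blaschke fder f_pole BE AB (circle_neq0 _ BC) hrep.
have count_B : disc_roots B = size sm.
  rewrite disc_rootsM ?disc_roots_blaschke_num ?disc_roots_blaschke_den ?addn0 //.
  - exact: circle_neq0.
  - by apply: circle_neq0 => u u1; rewrite dkC ?u1.
have count_Q : disc_roots Q = (size sk + 3)%N.
  have X3E : 'X^3 = blaschke_num (nseq 3 (0 : CC R)).
    by rewrite /blaschke_num big_nseq iter_mulr_1 subr0.
  rewrite disc_rootsM; last 2 first.
  - by rewrite -size_poly_eq0 size_polyXn.
  - apply: circle_neq0 => z z1; have := QC z z1.
    by rewrite hornerM mulf_eq0 negb_or => /andP[].
  rewrite disc_rootsZ // disc_rootsM; last 2 first.
  - exact: circle_neq0.
  - by apply: circle_neq0 => u u1; rewrite dmC ?u1.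
  rewrite X3E !disc_roots_blaschke_num ?disc_roots_blaschke_den ?addn0 1?addnC //.
  by move=> a; rewrite mem_nseq => /eqP ->; rewrite normr0.
split=> [b b1|a a1].
- have b0 : b != 0 by rewrite -normr_gt0 (lt_trans ltr01).
  have bV : `|b^-1| < 1 by rewrite normfV invf_lt1 // (lt_trans ltr01).
  have QBle u : `|u| = 1 -> `|Q.[u]| <= `|B.[u]| by move=> /QB ->.
  have E : Q - b *: B = - b *: (B - b^-1 *: Q).
    by rewrite scalerBr scalerA mulNr mulfV // !scaleNr scale1r opprK addrC.
  have <- : disc_roots (Q - b *: B) = size sm.
    by rewrite E disc_rootsZ ?oppr_eq0 // rouche.
  apply: nb_solutions_rational => //; apply: circle_neq0 => u u1.
  rewrite hornerD hornerN hornerZ subr_eq0; apply: contraTneq b1 => E1.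
  have : `|B.[u]| * 1 = `|B.[u]| * `|b| by rewrite mulr1 -normrM mulrC -E1 QB.
  by move=> /mulfI; rewrite normr_eq0 => /(_ (BC u u1)) <-; rewrite ltxx.
have BQle u : `|u| = 1 -> `|B.[u]| <= `|Q.[u]| by move=> /QB ->.
have <- : disc_roots (Q - a *: B) = (size sk + 3)%N by rewrite rouche.
apply: nb_solutions_rational => //; apply: circle_neq0 => u u1.
rewrite hornerD hornerN hornerZ subr_eq0; apply: contraTneq a1 => E1.
have : `|B.[u]| * 1 = `|B.[u]| * `|a| by rewrite mulr1 -normrM mulrC -E1 QB.
by move=> /mulfI; rewrite normr_eq0 => /(_ (BC u u1)) <-; rewrite ltxx.
Qed.
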